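(* Let $\delta\in[0,\tfrac12)$ and let $h(\delta)=-\delta\log_2\delta-(1-\delta)\log_2(1-\delta)$ (with $h(0)=0$). Let $(r_m)_{m\ge1}$ be integers with $0\le r_m\le m$ and \[\limsup_{m\to\infty}\frac{\binom{m}{\le r_m}}{2^m}<1-h(\delta),\qquad \binom{m}{\le r}:=\sum_{i=0}^{r}\binom{m}{i}.\] Then the bit-error probability of the Reed–Muller code $RM(m,r_m)$ on the binary symmetric channel with crossover probability $\delta$ satisfies $P_{\mathrm{bit}}=2^{-\Omega(\sqrt m)}$, i.e. there exist $c>0$ and $m_0$ such that $P_{\mathrm{bit}}\le 2^{-c\sqrt m}$ for all $m\ge m_0$.
   Context: For $m\ge1$ let $n=2^m$. The Reed–Muller code $RM(m,r)\subseteq\mathbb{F}_2^{n}$ is the set of evaluation vectors $(P(x))_{x\in\mathbb{F}_2^m}$ of all polynomials $P\in\mathbb{F}_2[x_1,\dots,x_m]$ of degree at most $r$. Transmission model: $X$ is a uniformly random codeword of $RM(m,r)$ (equivalently, the evaluation vector of a polynomial $\sum_{|A|\le r}u_A\prod_{i\in A}x_i$ with i.i.d. uniform coefficients $u_A\in\mathbb{F}_2$), $Z\in\mathbb{F}_2^n$ has i.i.d. Bernoulli$(\delta)$ coordinates independent of $X$, and $Y=X+Z$ is received. For a coordinate $x\in\mathbb{F}_2^m$, $\widehat{X_x}(Y)$ denotes the most likely value of $X_x$ given $Y$ (maximum a posteriori bitwise decision, ties broken arbitrarily), and $P_{\mathrm{bit}}:=\max_{x\in\mathbb{F}_2^m}\mathbb{P}(\widehat{X_x}(Y)\ne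 X_x)$. *)

(* Defs.v *)
From HB Require Import structures.
From mathcomp Require Import all_boot all_order all_algebra.
From mathcomp Require Import all_classical all_reals all_analysis.
Set Implicit Arguments. Unset Strict Implicit. Unset Printing Implicit Defensive.
Import Order.TTheory GRing.Theory Num.Theory.
Local Open Scope ring_scope.

(* Coordinates x in F_2^m, with F_2 represented by bool (xor = addition). *)
Definition Coord (m : nat) := {ffun 'I_m -> bool}.

(* Monomials prod_{i in A} x_i of degree |A| <= r. *)
Definition Mon (m r : nat) := {A : {set 'I_m} | #|A| <= r}%N.

Definition Coef (m r : nat) := {ffun Mon m r -> bool}.

(* Evaluation of sum_{|A|<=r} u_A prod_{i in A} x_i at x, over F_2. *)
Definition rm_eval (m r : nat) (u : Coef m r) (x : Coord m) : bool :=
  \big[addb/false]_(A : Mon m r) (u A && [forall i in val A, x i]).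

Definition rm_codeword (m r : nat) (u : Coef m r) : {ffun Coord m -> bool} :=
  [ffun x => rm_eval u x].

Definition received (m r : nat) (u : Coef m r) (z : {ffun Coord m -> bool})
  : {ffun Coord m -> bool} := [ffun x => rm_codeword u x (+) z x].

Section Prob.
Variable R : realType.

Definition noise_prob (m : nat) (delta : R) (z : {ffun Coord m -> bool}) : R :=
  \prod_(x : Coord m) (if z x then delta else 1 - delta).

Definition joint_prob (m r : nat) (delta : R) (u : Coef m r)
  (z : {ffun Coord m -> bool}) : R :=
  (#|{: Coef m r}|%:R)^-1 * noise_prob delta z.

Definition Prob (m r : nat) (delta : R)
  (E : Coef m r -> {ffun Coord m -> bool} -> bool) : R :=
  \sum_(u : Coef m r) \sum_(z : {ffun Coord m -> bool})
     (if E u z then joint_prob delta u z else 0).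

(* dec x y is a bitwise MAP decision for X_x given Y = y (ties arbitrary):
   P(X_x = dec x y, Y = y) >= P(X_x = ~~ dec x y, Y = y) for all x, y. *)
Definition is_bitMAP (m r : nat) (delta : R)
  (dec : Coord m -> {ffun Coord m -> bool} -> bool) : Prop :=
  forall (x : Coord m) (y : {ffun Coord m -> bool}),
    Prob delta (fun (u : Coef m r) z => (rm_codeword u x == ~~ dec x y) && (received u z == y))
    <= Prob delta (fun (u : Coef m r) z => (rm_codeword u x == dec x y) && (received u z == y)).

Definition Pbit (m r : nat) (delta : R)
  (dec : Coord m -> {ffun Coord m -> bool} -> bool) : R :=
  \big[Num.max/0]_(x : Coord m)
     Prob delta (fun (u : Coef m r) z => dec x (received u z) != rm_codeword u x).

Definition log2 (x : R) : R := ln x / ln 2.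
Definition binent (d : R) : R :=
  if d == 0 then 0 else - d * log2 d - (1 - d) * log2 (1 - d).

End Prob.

Definition binom_le (m r : nat) : nat := (\sum_(0 <= i < r.+1) 'C(m, i))%N.

(* Main.v *)
(* Entropy gives a weak decoder and averaging boosts it.  Below capacity,
   [H(Y) <= H(X) + H(Z)] keeps the output away from uniform, so by the chain rule
   some coordinate [i0] of [RM(d,r)] has a bounded soft estimator [F], not looking
   at position [i0], whose sign-corrected value depends on the noise only and has
   mean [>= mu > 0].  Restricting [RM(d+k,r)] to the affine graphs
   [{p + (y, A y)}], [A : F_2^d -> F_2^k], yields words of [RM(d,r)] and hence
   estimators of the bit at [p].  A point other than [p] lies on at most a
   fraction [2^-k] of these graphs, so the average of the estimators has variance
   [<= 2^-k], and its sign is wrong with probability [<= 2^-k / mu^2] by Chebyshev.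
   Passing from [m] to [d = m - k] costs [O(k / sqrt m)] in rate, which allows
   [k] of order [sqrt m]. *)

Require Import Defs.
From HB Require Import structures.
From mathcomp Require Import all_boot all_order all_algebra.
From mathcomp Require Import all_classical all_reals all_analysis.
From mathcomp Require Import zify ring lra.
Import Order.TTheory GRing.Theory Num.Theory.
Set Implicit Arguments.
Unset Strict Implicit.
Unset Printing Implicit Defensive.
Local Open Scope ring_scope.

(** * Product measures on the cube and partial averages *)

Section ProductMeasure.
Context {R : realType} {I : finType}.
Implicit Types (rho : bool -> R) (f g : {ffun I -> bool} -> R).
Implicit Types (z c : {ffun I -> bool}) (i : I) (s : seq I).

Definition upd z i b : {ffun I -> bool} := [ffun j => if j == i then b else z j].

Definition xorf z c : {ffun I -> bool} := [ffun j => z j (+) c j].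

Definition weight rho z : R := \prod_i rho (z i).

Definition expect rho f : R := \sum_z weight rho z * f z.

(** For [rho] of mass 1, the conditional expectation of [f] given all coordinates but [i]. *)
Definition avg rho i f z : R :=
  rho true * f (upd z i true) + rho false * f (upd z i false).

Definition avgs rho s f := foldr (avg rho) f s.

(** Functional rather than probabilistic independence: no law enters. *)
Definition indep i f := forall z b, f (upd z i b) = f z.

Lemma upd_id z i : upd z i (z i) = z.
Proof. by apply/ffunP => j; rewrite ffunE; case: eqP => // ->. Qed.

Lemma upd_upd z i b b' : upd (upd z i b) i b' = upd z i b'.
Proof. by apply/ffunP => j; rewrite !ffunE; case: eqP. Qed.

Lemma updE z i b : upd z i b i = b.
Proof. by rewrite ffunE eqxx. Qed.

Lemma updC z i j b b' : i != j -> upd (upd z i b) j b' = upd (upd z j b') i b.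
Proof.
move=> ij; apply/ffunP => l; rewrite !ffunE.
by case: (eqVneq l j) => // ->; rewrite eq_sym (negbTE ij).
Qed.

Lemma upd_xorf z c i b : upd (xorf z c) i b = xorf (upd z i (b (+) c i)) c.
Proof.
apply/ffunP => l; rewrite !ffunE; case: eqP => // ->.
by rewrite addbK.
Qed.

Lemma xorfK c : involutive (fun z => xorf z c).
Proof. by move=> z; apply/ffunP => j; rewrite !ffunE addbK. Qed.

Lemma weight_ge0 rho z : (forall b, 0 <= rho b) -> 0 <= weight rho z.
Proof. by move=> rho0; apply: prodr_ge0. Qed.

Lemma eq_expect rho f g : f =1 g -> expect rho f = expect rho g.
Proof. by move=> fg; apply: eq_bigr => z _; rewrite fg. Qed.

Lemma expectD rho f g :
  expect rho (fun z => f z + g z) = expect rho f + expect rho g.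
Proof. by rewrite -big_split; apply: eq_bigr => z _ /=; rewrite mulrDr. Qed.

Lemma expectZ rho (a : R) f : expect rho (fun z => a * f z) = a * expect rho f.
Proof. by rewrite /expect mulr_sumr; apply: eq_bigr => z _; rewrite mulrCA. Qed.

Lemma expectB rho f g :
  expect rho (fun z => f z - g z) = expect rho f - expect rho g.
Proof. by rewrite -sumrB; apply: eq_bigr => z _ /=; rewrite mulrBr. Qed.

Lemma expect_sum (T : finType) (P : pred T) rho (f : T -> {ffun I -> bool} -> R) :
  expect rho (fun z => \sum_(a | P a) f a z) = \sum_(a | P a) expect rho (f a).
Proof.
rewrite /expect exchange_big; apply: eq_bigr => z _ /=; by rewrite mulr_sumr.
Qed.

Lemma le_expect rho f g : (forall b, 0 <= rho b) -> (forall z, f z <= g z) ->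
  expect rho f <= expect rho g.
Proof.
by move=> rho0 fg; apply: ler_sum => z _; rewrite ler_wpM2l ?weight_ge0.
Qed.

Lemma sum_weight rho : rho true + rho false = 1 -> \sum_z weight rho z = 1.
Proof.
move=> rho1; rewrite /weight -(bigA_distr_bigA (fun _ b => rho b)) big1// => i _.
by rewrite big_bool.
Qed.

Lemma expect_cst rho (a : R) : rho true + rho false = 1 -> expect rho (fun=> a) = a.
Proof. by move=> rho1; rewrite /expect -mulr_suml sum_weight ?mul1r. Qed.

Lemma expect_avg rho i f : rho true + rho false = 1 ->
  expect rho (avg rho i f) = expect rho f.
Proof.
move=> rho1; pose w z := \prod_(j | j != i) rho (z j).
have wE z : weight rho z = rho (z i) * w z by rewrite /weight (bigD1 i).
have wu z b : w (upd z i b) = w z.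
  by apply: eq_bigr => j /negbTE ji; rewrite ffunE ji.
pose flip z := upd z i (~~ z i).
have flipK : involutive flip.
  by move=> z; rewrite /flip updE upd_upd negbK upd_id.
(* One term of the average sits at [z], the other at its flip in coordinate [i]. Reindexing the
   latter by the flip collects the mass [rho (z i) + rho (~~ z i)] in front of [f z]. *)
have -> : expect rho (avg rho i f) =
    \sum_(z : {ffun I -> bool}) (rho (z i) * w z * (rho (z i) * f z) +
            rho (z i) * w z * (rho (~~ z i) * f (flip z))).
  apply: eq_bigr => z _; rewrite -mulrDr wE; congr (_ * _).
  rewrite /avg /flip -[in X in _ = _ * f X + _](upd_id z i).
  by case: (z i) => //=; rewrite addrC.
rewrite big_split /= [X in _ + X](reindex_inj (can_inj flipK)) /= -big_split /=.
apply: eq_bigr => z _; rewrite flipK /flip updE wu negbK wE.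
have rhoz : rho (z i) + rho (~~ z i) = 1.
  by case: (z i) => //=; rewrite addrC.
by rewrite -[RHS]mulr1 -rhoz; ring.
Qed.

Lemma avg_mulr rho i f g : indep i f ->
  avg rho i (fun z => f z * g z) = fun z => f z * avg rho i g z.
Proof. by move=> fi; apply/funext => z; rewrite /avg !fi; ring. Qed.

Lemma indep_avg rho i f : indep i (avg rho i f).
Proof. by move=> z b; rewrite /avg !upd_upd. Qed.

Lemma indep_avgS rho i j f : indep j f -> indep j (avg rho i f).
Proof.
move=> fj z b; rewrite /avg; case: (eqVneq i j) => [->|ij]; first by rewrite !upd_upd.
by rewrite -!(updC _ _ _ ij) !fj.
Qed.

Lemma indep_avgs rho s j f : j \in s \/ indep j f -> indep j (avgs rho s f).
Proof.
elim: s => [|i s IH] /=; first by case.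
rewrite inE => -[/orP[/eqP ->|js]|fj].
- exact: indep_avg.
- by apply: indep_avgS; apply: IH; left.
- by apply: indep_avgS; apply: IH; right.
Qed.

Lemma expect_avgs rho s f : rho true + rho false = 1 ->
  expect rho (avgs rho s f) = expect rho f.
Proof. by move=> rho1; elim: s => //= i s IH; rewrite expect_avg. Qed.

(** A factor blind to the coordinates in [s] passes through each average, and averages preserve the
    expectation. *)
Lemma expect_avgs_mul rho s f g : rho true + rho false = 1 ->
  (forall i, i \in s -> indep i g) ->
  expect rho (fun z => g z * avgs rho s f z) = expect rho (fun z => g z * f z).
Proof.
move=> rho1; elim: s => //= i s IH gi.
rewrite -avg_mulr; last by apply: gi; rewrite mem_head.
by rewrite expect_avg// IH// => j js; apply: gi; rewrite inE js orbT.
Qed.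

Lemma avgs_local rho s f z z' : (forall j, j \notin s -> z j = z' j) ->
  avgs rho s f z = avgs rho s f z'.
Proof.
elim: s z z' => [|i s IH] z z' zz' /=.
  by congr f; apply/ffunP => j; apply: (zz' j).
have H b : forall j, j \notin s -> upd z i b j = upd z' i b j.
  move=> j js; rewrite !ffunE; case: eqP => // /eqP ji.
  by apply: zz'; rewrite inE negb_or ji.
by rewrite /avg !(IH _ _ (H _)).
Qed.

Lemma avgs_enum rho f z : rho true + rho false = 1 ->
  avgs rho (enum I) f z = expect rho f.
Proof.
move=> rho1; rewrite -(expect_avgs (enum I) f rho1).
rewrite (@eq_expect _ _ (fun=> avgs rho (enum I) f z)) ?expect_cst// => z'.
by apply: avgs_local => j; rewrite mem_enum.
Qed.

Lemma avgs_sum (T : finType) rho s (f : T -> {ffun I -> bool} -> R) :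
  avgs rho s (fun z => \sum_a f a z) = fun z => \sum_a avgs rho s (f a) z.
Proof.
elim: s => //= i s ->; apply/funext => z.
by rewrite /avg !mulr_sumr -big_split.
Qed.

Lemma avg_ge0 rho i f : (forall b, 0 <= rho b) -> (forall z, 0 <= f z) ->
  forall z, 0 <= avg rho i f z.
Proof. by move=> rho0 f0 z; rewrite addr_ge0// mulr_ge0. Qed.

Lemma avgs_ge0 rho s f : (forall b, 0 <= rho b) -> (forall z, 0 <= f z) ->
  forall z, 0 <= avgs rho s f z.
Proof. by move=> rho0 f0; elim: s => //= i s IH; apply: avg_ge0. Qed.

(** The shift by [c] at most exchanges the two terms of each average, harmless for a law symmetric
    in the bit. *)
Lemma avgs_xorf rho s f c : (forall b, rho b = rho (~~ b)) ->
  (forall z, f (xorf z c) = f z) -> forall z, avgs rho s f (xorf z c) = avgs rho s f z.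
Proof.
move=> rhoN fc; elim: s => //= i s IH z; rewrite /avg !upd_xorf !IH.
by case: (c i) => //=; rewrite (rhoN false) /= addrC.
Qed.

(** Pythagoras: averaging acts as an orthogonal projection for the pairing given by [expect rho]. *)
Lemma expect_sqr_avg rho i f : rho true + rho false = 1 ->
  expect rho (fun z => (f z - avg rho i f z) ^+ 2) =
  expect rho (fun z => f z ^+ 2) - expect rho (fun z => avg rho i f z ^+ 2).
Proof.
move=> rho1.
have cross : expect rho (fun z => avg rho i f z * f z) =
             expect rho (fun z => avg rho i f z ^+ 2).
  rewrite -(expect_avg i _ rho1) avg_mulr; last exact: indep_avg.
  by apply: eq_expect => z; rewrite expr2.
rewrite (@eq_expect _ _ (fun z => f z ^+ 2 + avg rho i f z ^+ 2 -
  2 * (avg rho i f z * f z))); last by move=> z; ring.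
by rewrite expectB expectD expectZ cross; ring.
Qed.

End ProductMeasure.

(** * Variance of sums in which each coordinate affects few terms *)

Lemma sqr_sum_le (R : realType) (T : finType) (D : {set T}) (x : T -> R) :
  (\sum_(a in D) x a) ^+ 2 <= #|D|%:R * \sum_(a in D) x a ^+ 2.
Proof.
have -> : #|D|%:R * \sum_(a in D) x a ^+ 2 =
   \sum_(a in D) \sum_(b in D) (x a ^+ 2 + x b ^+ 2) / 2.
  under [RHS]eq_bigr do rewrite -mulr_suml big_split /= sumr_const.
  rewrite -mulr_suml big_split /= sumr_const sumrMnl.
  by rewrite -mulr2n -[X in _ = X / _]mulr_natr mulfK ?pnatr_eq0// mulr_natl.
rewrite expr2 big_distrlr /=; apply: ler_sum => a _; apply: ler_sum => b _.
have := sqr_ge0 (x a - x b); rewrite sqrrB mulr2n.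
set u := x a ^+ 2; set v := x b ^+ 2; set w := x a * x b => H; lra.
Qed.

(* Martingale differences in direction [i] vanish for all but [K] of the
   summands, so Cauchy-Schwarz gains the factor [K / #|T|] over the trivial bound. *)
Lemma variance_sum_le (R : realType) (I T : finType) (rho : bool -> R)
    (f : T -> {ffun I -> bool} -> R) (D : I -> {set T}) (K : R) :
  (forall b, 0 <= rho b) -> rho true + rho false = 1 ->
  0 <= K -> (forall i a, a \notin D i -> indep i (f a)) -> (forall i, #|D i|%:R <= K) ->
  expect rho (fun z => (\sum_a f a z) ^+ 2) - expect rho (fun z => \sum_a f a z) ^+ 2
    <= K * \sum_a expect rho (fun z => f a z ^+ 2).
Proof.
move=> rho0 rho1 K0 fD DK; pose S z := \sum_a f a z.
(* Integrating out one more coordinate adds one martingale difference to each side; the full list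
   leaves [S] at its mean. *)
have step s : expect rho (fun z => S z ^+ 2) - expect rho (fun z => avgs rho s S z ^+ 2)
   <= K * \sum_a (expect rho (fun z => f a z ^+ 2) -
                     expect rho (fun z => avgs rho s (f a) z ^+ 2)).
  elim: s => [|i s IH] /=.
    by rewrite subrr big1 ?mulr0// => a _; rewrite subrr.
  suff H : expect rho (fun z => avgs rho s S z ^+ 2) -
           expect rho (fun z => avg rho i (avgs rho s S) z ^+ 2) <=
     K * \sum_a (expect rho (fun z => avgs rho s (f a) z ^+ 2) -
                    expect rho (fun z => avg rho i (avgs rho s (f a)) z ^+ 2)).
    have := lerD IH H; rewrite -mulrDr -big_split /=.
    under eq_bigr do rewrite addrA subrK.
    by rewrite addrA subrK.
  rewrite -expect_sqr_avg//.
  under eq_bigr do rewrite -expect_sqr_avg//.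
  rewrite -expect_sum -expectZ; apply: le_expect => // z.
  pose x a := avgs rho s (f a) z - avg rho i (avgs rho s (f a)) z.
  have x0 a : a \notin D i -> x a = 0.
    move=> /fD fi; rewrite /x /avg !(indep_avgs rho (or_intror fi)).
    by rewrite -mulrDl rho1 mul1r subrr.
  (* Used with [h] the identity and the square, to confine both sums to [D i] before
     Cauchy-Schwarz. *)
  have xD (h : R -> R) : h 0 = 0 -> \sum_a h (x a) = \sum_(a in D i) h (x a).
    move=> h0; rewrite [LHS](bigID (mem (D i))) /= [X in _ + X]big1 ?addr0// => a aD.
    by rewrite x0.
  have -> : avgs rho s S z - avg rho i (avgs rho s S) z = \sum_a x a.
    by rewrite avgs_sum /x /avg sumrB big_split /= !mulr_sumr.
  rewrite -/x -[X in _ <= _ * X]/(\sum_a x a ^+ 2).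
  have /= -> := xD id erefl.
  have /= -> := xD (fun y => y ^+ 2) (expr0n _ _).
  apply: (le_trans (sqr_sum_le _ _)).
  by rewrite ler_wpM2r // sumr_ge0// => a _; rewrite sqr_ge0.
have := step (enum I).
rewrite (@eq_expect _ _ _ (fun z => avgs rho (enum I) S z ^+ 2) (fun=> expect rho S ^+ 2));
  last by move=> z; rewrite avgs_enum.
rewrite expect_cst// => /le_trans; apply; apply: ler_wpM2l => //.
apply: ler_sum => a _; rewrite gerBl -(@expect_cst _ I _ 0 rho1).
by apply: le_expect => // z; rewrite sqr_ge0.
Qed.

(** * Bit laws and entropy in nats *)

Definition half {R : realType} (b : bool) : R := 2^-1.

Definition bsc {R : realType} (delta : R) (b : bool) : R :=
  if b then delta else 1 - delta.

Lemma half_ge0 (R : realType) b : 0 <= half b :> R.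
Proof. by rewrite /half invr_ge0. Qed.

Lemma half_sum (R : realType) : half true + half false = 1 :> R.
Proof. by rewrite /half; lra. Qed.

Lemma bsc_sum (R : realType) (delta : R) : bsc delta true + bsc delta false = 1.
Proof. by rewrite /bsc addrC subrK. Qed.

Lemma bsc_ge0 (R : realType) (delta : R) b : 0 <= delta -> delta <= 1 -> 0 <= bsc delta b.
Proof. by case: b => //= _; rewrite subr_ge0. Qed.

Lemma weight_half (R : realType) (I : finType) (z : {ffun I -> bool}) :
  weight half z = 2^-1 ^+ #|I| :> R.
Proof. by rewrite /weight prodr_const. Qed.

Lemma binentE (R : realType) (delta : R) :
  ln 2 * binent delta = - (delta * ln delta + (1 - delta) * ln (1 - delta)).
Proof.
have ln2 : ln 2 != 0 :> R by rewrite gt_eqF// ln_gt0// ltr1n.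
rewrite /binent /log2; case: eqP => [->|_]; last by field.
by rewrite mul0r subr0 ln1 !mulr0 add0r oppr0.
Qed.

(** Tangent bound [ln (1 + t) <= t] at [t = a / M - 1]. Summed over two values with mean [M], it
    bounds an entropy difference by a chi-square term; the premise on [M = 0] admits vanishing
    densities. *)
Lemma xlnx_le (R : realType) (a M : R) : 0 <= a -> (M = 0 -> a = 0) -> 0 <= M ->
  a * ln a <= a * ln M + a * (a / M - 1).
Proof.
move=> a0 Ma M0; have [->|a_neq0] := eqVneq a 0; first by rewrite !mul0r addr0.
have a_gt0 : 0 < a by rewrite lt_def a_neq0.
have M_gt0 : 0 < M by rewrite lt_def M0 andbT; apply/eqP => /Ma/eqP; apply/negP.
rewrite -mulrDr ler_wpM2l// -lerBlDl -ln_div ?posrE//.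
have aM : 0 < a / M by rewrite divr_gt0.
have := @le_ln1Dx R (a / M - 1); rewrite (_ : 1 + (a / M - 1) = a / M); last by ring.
by apply; lra.
Qed.

(** * Output law of a linear code and soft estimators of one coordinate *)

Section Estimator.
Context {R : realType} {I J : finType}.
Variables (delta : R) (code : {ffun J -> bool} -> {ffun I -> bool}).
Hypotheses (delta_ge0 : 0 <= delta) (delta_le1 : delta <= 1).
Hypothesis codeD : forall u v, code (xorf u v) = xorf (code u) (code v).

Let rho := bsc delta.
Let rho_ge0 b : 0 <= rho b. Proof. exact: bsc_ge0. Qed.
Let rho_sum : rho true + rho false = 1. Proof. exact: bsc_sum. Qed.

(* The law of the channel output, as a density with respect to the uniform law. *)
Definition output_density (z : {ffun I -> bool}) : R :=
  2 ^+ #|I| * (#|{ffun J -> bool}|%:R^-1 * \sum_u weight rho (xorf z (code u))).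

Local Notation q := output_density.

Lemma output_density_ge0 z : 0 <= q z.
Proof.
by rewrite !mulr_ge0 ?exprn_ge0 ?invr_ge0// sumr_ge0// => u _; apply: weight_ge0.
Qed.

Lemma output_density_code z v : q (xorf z (code v)) = q z.
Proof.
congr (_ * (_ * _)); rewrite [RHS](reindex_inj (can_inj (xorfK v))) /=.
apply: eq_bigr => u _; rewrite codeD; congr weight.
by apply/ffunP => j; rewrite !ffunE -addbA [code v j (+) _]addbC.
Qed.

(** The output is the noise shifted by a random codeword, a shift that [h] does not notice. *)
Lemma expect_output_density (h : {ffun I -> bool} -> R) :
  (forall u z, h (xorf z (code u)) = h z) ->
  expect half (fun z => q z * h z) = expect rho h.
Proof.
move=> hc; rewrite /expect.
have U0 : #|{ffun J -> bool}|%:R != 0 :> R.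
  by rewrite card_ffun card_bool pnatr_eq0 expn_eq0.
transitivity (#|{ffun J -> bool}|%:R^-1 *
    \sum_(u : {ffun J -> bool}) \sum_z weight rho (xorf z (code u)) * h z).
  rewrite exchange_big mulr_sumr; apply: eq_bigr => z _.
  rewrite weight_half /output_density -mulr_suml !mulrA.
  by rewrite -exprMn mulVf ?pnatr_eq0// expr1n mul1r.
rewrite (eq_bigr (fun=> expect rho h)); last first.
  move=> u _; rewrite /expect [RHS](reindex_inj (can_inj (xorfK (code u)))) /=.
  by apply: eq_bigr => z _; rewrite hc.
by rewrite sumr_const -[X in _ * X]mulr_natl mulrA mulVf// mul1r.
Qed.

Lemma expect_ln_weight :
  expect rho (fun z : {ffun I -> bool} => ln (weight rho z)) = - (#|I|%:R * (ln 2 * binent delta)).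
Proof.
(* Words of weight 0 are set apart: the logarithm of a product splits over positive factors. *)
have lnw (z : {ffun I -> bool}) : weight rho z * ln (weight rho z) = weight rho z * \sum_i ln (rho (z i)).
  have [->|w0] := eqVneq (weight rho z) 0; first by rewrite !mul0r.
  congr (_ * _).
  have rz i : 0 < rho (z i).
    by rewrite lt_def rho_ge0 andbT; apply: (prodf_neq0 _ _ w0).
  rewrite /weight.
  suff [] : 0 < \prod_i rho (z i) /\ ln (\prod_i rho (z i)) = \sum_i ln (rho (z i)) by [].
  elim/big_rec2 : _ => [|i y1 y2 _ [y2_gt0 IH]]; first by rewrite ln1 ltr01.
  by rewrite mulr_gt0// lnM ?posrE// IH.
rewrite /expect (eq_bigr _ (fun z _ => lnw z)).
rewrite -[LHS]/(expect rho (fun z => \sum_i ln (rho (z i)))) expect_sum.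
rewrite (eq_bigr (fun=> - (ln 2 * binent delta))); last first.
  move=> i _; rewrite -(expect_avg i _ rho_sum) -[RHS](@expect_cst _ I _ _ rho_sum).
  by apply: eq_expect => z; rewrite /avg !updE binentE opprK.
by rewrite sumr_const -[LHS]mulr_natl mulrN.
Qed.

(** Only the zero codeword is kept in the sum over [u]. This pointwise bound is the source of
    [H(Y) <= H(X) + H(Z)]. *)
Lemma output_density_ge_weight z :
  2 ^+ #|I| * ((2 ^+ #|J|)^-1 * weight rho z) <= q z.
Proof.
pose u0 : {ffun J -> bool} := [ffun=> false].
have u0E : code u0 = [ffun=> false].
  have <- : xorf u0 u0 = u0 by apply/ffunP => j; rewrite !ffunE.
  by rewrite codeD; apply/ffunP => j; rewrite !ffunE addbb.
rewrite /output_density card_ffun card_bool natrX.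
rewrite !ler_wpM2l ?invr_ge0 ?exprn_ge0// (bigD1 u0)//= u0E.
rewrite (_ : xorf z _ = z); last by apply/ffunP => j; rewrite !ffunE addbF.
by rewrite lerDl sumr_ge0// => u _; apply: weight_ge0.
Qed.

(** The right side is the divergence of the output from the uniform law. By invariance under
    codewords it is the mean of [ln q] over the noise, where the pointwise bound applies. *)
Lemma output_entropy_ge :
  #|I|%:R * ln 2 - #|J|%:R * ln 2 - #|I|%:R * (ln 2 * binent delta)
    <= expect half (fun z => q z * ln (q z)).
Proof.
rewrite (@expect_output_density (fun z => ln (q z))); last first.
  by move=> u z; rewrite output_density_code.
rewrite -expect_ln_weight -[X in X + _](@expect_cst _ I _ _ rho_sum) -expectD.
apply: ler_sum => z _.
have [->|w0] := eqVneq (weight rho z) 0; first by rewrite !mul0r.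
have w_gt0 : 0 < weight rho z by rewrite lt_def w0 weight_ge0.
rewrite ler_wpM2l ?(ltW w_gt0)//.
have <- : ln (2 ^+ #|I| * ((2 ^+ #|J|)^-1 * weight rho z)) =
         #|I|%:R * ln 2 - #|J|%:R * ln 2 + ln (weight rho z).
  rewrite !lnM ?lnV ?lnXn ?posrE ?mulr_gt0 ?invr_gt0 ?exprn_gt0//.
  by rewrite !mulr_natl addrA.
have low_gt0 : 0 < 2 ^+ #|I| * ((2 ^+ #|J|)^-1 * weight rho z).
  by rewrite !mulr_gt0 ?invr_gt0 ?exprn_gt0.
rewrite ler_ln ?posrE//; first exact: output_density_ge_weight.
exact: lt_le_trans low_gt0 (output_density_ge_weight z).
Qed.

(** By the last clause, [(-1) ^+ X_i * F Y = F Z] for sent word [X] and noise [Z], so the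
    correlation with the sent bit is a mean over the noise alone. *)
Definition is_estimator i (F : {ffun I -> bool} -> R) :=
  [/\ forall z, `|F z| <= 1, indep i F &
      forall u z, F (xorf z (code u)) = (-1) ^+ code u i * F z].

(** [F] is the bias of the output bit at [i] given the coordinates outside [i :: s]. Averaging out
    [i] costs at most a chi-square term, which is the correlation of [F] with that output bit; the
    noise at [i], independent of [F], contributes [1 - 2 * delta]. *)
Lemma entropy_step s i : i \notin s ->
  exists F, is_estimator i F /\
    expect half (fun z => avgs half s q z * ln (avgs half s q z)) -
    expect half (fun z => avgs half (i :: s) q z * ln (avgs half (i :: s) q z))
     <= (1 - 2 * delta) * expect rho F.
Proof.
move=> si; set g := avgs half s q.
have g0 z : 0 <= g z.
  by apply: avgs_ge0 => [b|z']; [exact: half_ge0 | exact: output_density_ge0].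
have gc u z : g (xorf z (code u)) = g z.
  by apply: avgs_xorf => // z'; rewrite output_density_code.
pose gf z := g (upd z i false); pose gt z := g (upd z i true).
pose F z := (gf z - gt z) / (gf z + gt z).
have iF : indep i F by move=> z b; rewrite /F /gf /gt !upd_upd.
have estF : is_estimator i F.
  split => // [z|u z].
    have := g0 (upd z i false); have := g0 (upd z i true).
    rewrite /F -/(gf z) -/(gt z) => gt0 gf0.
    have [->|n0] := eqVneq (gf z + gt z) 0; first by rewrite invr0 mulr0 normr0.
    have s0 : 0 < gf z + gt z by rewrite lt_def n0 addr_ge0.
    by rewrite normrM normfV (gtr0_norm s0) ler_pdivrMr// mul1r ler_norml; lra.
  rewrite /F /gf /gt !upd_xorf !gc; case: (code u i) => /=; last by rewrite mul1r.
  by rewrite expr1 [X in _ / X]addrC; ring.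
exists F; split => //.
pose sgn (z : {ffun I -> bool}) : R := (-1) ^+ z i.
have -> : (1 - 2 * delta) * expect rho F = expect half (fun z => F z * sgn z * g z).
  (* [F] and [sgn] ignore the coordinates in [s], so [g] may be replaced by [q]. *)
  rewrite expect_avgs_mul ?half_sum//; last first.
    move=> j js z b; have ji := memPn si _ js.
    have gj : indep j g by apply: indep_avgs; left.
    by rewrite /F /gf /gt !(updC _ _ _ ji) !gj /sgn ffunE eq_sym (negbTE ji).
  rewrite (@eq_expect _ _ half _ (fun z => q z * (F z * sgn z)));
    last by move=> z; rewrite [RHS]mulrC.
  (* A codeword shift gives [F] and [sgn] the same sign, which cancels in the product. *)
  rewrite expect_output_density; last first.
    move=> u z; have [_ _ ->] := estF; rewrite /sgn ffunE signr_addb.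
    by case: (code u i) => /=; ring.
  rewrite -[RHS](expect_avg i _ rho_sum) avg_mulr// -expectZ; apply: eq_expect => z.
  by rewrite /avg /sgn !updE /rho /bsc /=; ring.
rewrite -(expect_avg i (fun z => g z * ln (g z)) (half_sum R)).
rewrite -(expect_avg i (fun z => F z * sgn z * g z) (half_sum R)) -expectB.
apply: le_expect => [b|z]; first exact: half_ge0.
rewrite [avgs half (i :: s) q z]/(avg half i g z) /avg -/(gf z) -/(gt z) !iF /sgn !updE.
rewrite /= expr0 expr1 /half /F.
have gt0 : 0 <= gt z by exact: g0.
have gf0 : 0 <= gf z by exact: g0.
set M := 2^-1 * gt z + 2^-1 * gf z.
have M0 : 0 <= M by rewrite addr_ge0 ?mulr_ge0 ?invr_ge0.
have Mt : M = 0 -> gt z = 0 by rewrite /M; lra.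
have Mf : M = 0 -> gf z = 0 by rewrite /M; lra.
have := xlnx_le gt0 Mt M0; have := xlnx_le gf0 Mf M0.
have -> : gf z + gt z = 2 * M by rewrite /M; lra.
have [Me|Mn] := eqVneq M 0; first by rewrite Mt ?Mf// !Me; lra.
move=> H1 H2.
(* Both sides equal [(gf z - gt z) ^+ 2 / (4 * M)]. *)
have -> : 2^-1 * ((gf z - gt z) / (2 * M) * -1 * gt z) +
          2^-1 * ((gf z - gt z) / (2 * M) * 1 * gf z) =
   2^-1 * (gt z * (gt z / M - 1)) + 2^-1 * (gf z * (gf z / M - 1)).
  have -> : gf z = 2 * M - gt z by rewrite /M; lra.
  by field.
have -> : M * ln M = 2^-1 * (gt z * ln M) + 2^-1 * (gf z * ln M) by rewrite /M; ring.
lra.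
Qed.

(* If no estimator were correlated with its coordinate, the chain rule would
   make the output almost uniform, contradicting [H(Y) <= H(X) + H(Z)]. *)
Lemma exists_estimator (eps : R) : delta < 1 / 2 -> (0 < #|I|)%N -> 0 < eps ->
  eps <= 1 - #|J|%:R / #|I|%:R - binent delta ->
  exists i F, is_estimator i F /\ ln 2 * eps <= expect rho F.
Proof.
move=> delta_lt I0 eps0 epsle.
have ln20 : 0 < ln 2 :> R by rewrite ln_gt0// ltr1n.
apply: contrapT => no.
have small i F : is_estimator i F -> (1 - 2 * delta) * expect rho F < ln 2 * eps.
  move=> est; rewrite ltNge; apply/negP => le; apply: no; exists i, F; split => //.
  have EF0 : 0 < expect rho F.
    rewrite -(pmulr_rgt0 _ (_ : 0 < 1 - 2 * delta)); last by lra.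
    by apply: lt_le_trans le; rewrite mulr_gt0.
  apply: le_trans le _; by rewrite ler_piMl ?(ltW EF0)// gerBl mulr_ge0.
(* Telescoping over the list; the strict inequality needs at least one step, hence a nonempty
   list. *)
have chain i s : uniq (i :: s) -> expect half (fun z => q z * ln (q z)) -
    expect half (fun z => avgs half (i :: s) q z * ln (avgs half (i :: s) q z)) <
    (size s).+1%:R * (ln 2 * eps).
  elim: s i => [|j s IH] i /andP[/entropy_step[F [est step]] us].
    by rewrite mul1r; apply: le_lt_trans step (small _ _ est).
  move: (IH j us) (small _ _ est) step; rewrite /= -[_.+2%:R]natr1 mulrDl mul1r; lra.
have q1 : expect half q = 1.
  rewrite -[RHS](@expect_cst _ I _ _ rho_sum) -(expect_output_density (h := fun=> 1))//.
  by apply: eq_expect => z; rewrite mulr1.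
case def_s: (enum I) (enum_uniq I) (cardE I) => [|i s] us In; first by rewrite In in I0.
have := chain i s us; rewrite -def_s.
(* With every coordinate averaged out, the density is its total mass 1, whose logarithm is 0. *)
rewrite (@eq_expect _ _ _ (fun z => avgs half (enum I) q z * _ ) (fun=> 0));
  last by move=> z; rewrite avgs_enum ?half_sum// q1 ln1 mulr0.
rewrite expect_cst ?half_sum// subr0 -[_.+1]/(size (i :: s)) -In => lt.
have := le_lt_trans output_entropy_ge lt; apply/negP; rewrite -leNgt.
have n0 : 0 < #|I|%:R :> R by rewrite ltr0n.
rewrite (_ : _ - _ = #|I|%:R * (ln 2 * (1 - #|J|%:R / #|I|%:R - binent delta))).
  by rewrite !ler_wpM2l// ltW.
by field; rewrite gt_eqF.
Qed.

End Estimator.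

(** * Reed-Muller codewords as functions of bounded degree *)

Lemma rm_codewordE m r (u : Coef m r) x : rm_codeword u x = rm_eval u x.
Proof. by rewrite ffunE. Qed.

Lemma rm_codewordD m r (u v : Coef m r) :
  rm_codeword (xorf u v) = xorf (rm_codeword u) (rm_codeword v).
Proof.
apply/ffunP => x; rewrite !ffunE -big_split /=; apply: eq_bigr => A _.
by rewrite ffunE andb_addl.
Qed.

Lemma card_Coord m : #|Coord m| = (2 ^ m)%N.
Proof. by rewrite card_ffun card_bool card_ord. Qed.

Lemma card_Mon m r : #|{: Mon m r}| = binom_le m r.
Proof.
rewrite card_sig /binom_le big_mkord -sum1_card.
rewrite (partition_big (fun A : {set 'I_m} => inord #|A| : 'I_r.+1) predT)//=.
apply: eq_bigr => i _; rewrite -[in RHS](card_ord m) -card_draws -sum1_card.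
apply: eq_bigl => A; rewrite !inE -val_eqE /=.
have [Ar|Ar] := leqP #|A| r; first by rewrite inordK.
by apply/esym/eqP => Ai; move: (ltn_ord i); rewrite ltnS -Ai leqNgt Ar.
Qed.

(** Degree at most [r] as a property of functions, so that closure rules replace work with
    coefficients. *)
Definition rm_fun m r (f : Coord m -> bool) := exists u : Coef m r, rm_eval u =1 f.

Section RMFun.
Variable m : nat.
Implicit Types (r s : nat) (f g : Coord m -> bool).

Lemma eq_rm_fun r f g : f =1 g -> rm_fun r f -> rm_fun r g.
Proof. by move=> fg [u uf]; exists u => x; rewrite uf fg. Qed.

Lemma rm_fun0 r : rm_fun r (fun _ : Coord m => false).
Proof. by exists [ffun=> false] => x; apply: big1 => A _; rewrite ffunE. Qed.

Lemma rm_funD r f g : rm_fun r f -> rm_fun r g -> rm_fun r (fun x => f x (+) g x).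
Proof.
move=> [u uf] [v vg]; exists (xorf u v) => x.
by rewrite -rm_codewordE rm_codewordD ffunE !rm_codewordE uf vg.
Qed.

Lemma rm_fun_sum r (T : Type) (s : seq T) (f : T -> Coord m -> bool) :
  (forall a, rm_fun r (f a)) -> rm_fun r (fun x => \big[addb/false]_(a <- s) f a x).
Proof.
move=> rf; elim: s => [|a s IH].
  by apply: eq_rm_fun (rm_fun0 r) => x; rewrite big_nil.
by apply: eq_rm_fun (rm_funD (rf a) IH) => x; rewrite big_cons.
Qed.

Lemma rm_fun_mon r (A : {set 'I_m}) : (#|A| <= r)%N ->
  rm_fun r (fun x => [forall i in A, x i]).
Proof.
move=> Ar; pose A' : Mon m r := Sub A Ar.
exists [ffun B => B == A'] => x; rewrite /rm_eval (bigD1 A')//= ffunE eqxx.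
by rewrite big1 ?addbF// => B /negbTE BA; rewrite ffunE BA.
Qed.

(** Since [x^2 = x] over F_2, two monomials multiply to the monomial of the union of their index
    sets. *)
Lemma rm_funM r s f g : rm_fun r f -> rm_fun s g ->
  rm_fun (r + s) (fun x => f x && g x).
Proof.
move=> [u uf] [v vg].
apply: (@eq_rm_fun _ (fun x => \big[addb/false]_(A : Mon m r) \big[addb/false]_(B : Mon m s)
   ((u A && v B) && [forall i in val A :|: val B, x i]))) => [x|].
  rewrite -uf -vg /rm_eval big_distrlr /=.
  apply: eq_bigr => A _; apply: eq_bigr => B _; rewrite andbACA; congr (_ && _).
  apply/forallP/andP => [AB|[/forallP xA /forallP xB] i].
    by split; apply/forallP => i; apply/implyP => iA;
      apply: (implyP (AB i)); rewrite inE iA ?orbT.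
  by rewrite inE; apply/implyP => /orP[]; apply/implyP.
apply: rm_fun_sum => A; apply: rm_fun_sum => B; case: (u A && v B).
  apply: rm_fun_mon; rewrite (leq_trans (leq_card_setU _ _))//.
  by rewrite leq_add// (valP A, valP B).
exact: rm_fun0.
Qed.

Lemma rm_fun_le r s f : (r <= s)%N -> rm_fun r f -> rm_fun s f.
Proof.
move=> rs [u uf]; apply: (eq_rm_fun uf); apply: rm_fun_sum => A.
case: (u A); last exact: rm_fun0.
by apply: rm_fun_mon; apply: leq_trans rs; apply: (valP A).
Qed.

Lemma rm_fun_cst r b : rm_fun r (fun _ : Coord m => b).
Proof.
case: b; last exact: rm_fun0.
apply: (@eq_rm_fun _ (fun x => [forall i in (finset.set0 : {set 'I_m}), x i])) => [x|].
  by apply/forallP => i; rewrite inE.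
by apply: rm_fun_mon; rewrite cards0.
Qed.

Lemma rm_fun_var i : rm_fun 1 (fun x : Coord m => x i).
Proof.
apply: (@eq_rm_fun _ (fun x => [forall j in [set i], x j])) => [x|].
  apply/forallP/idP => [/(_ i)|xi j]; first by rewrite inE eqxx.
  by rewrite inE; apply/implyP => /eqP ->.
by apply: rm_fun_mon; rewrite cards1.
Qed.

End RMFun.

(** A monomial on [A] becomes a product of [#|A|] functions of degree at most 1. *)
Lemma rm_fun_comp d m r (phi : Coord d -> Coord m) (u : Coef m r) :
  (forall i, rm_fun 1 (fun x => phi x i)) -> rm_fun r (fun x => rm_eval u (phi x)).
Proof.
move=> phi1; apply: rm_fun_sum => A; case: (u A); last exact: rm_fun0.
have H (s : seq 'I_m) : rm_fun (size s) (fun x => all (phi x) s).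
  elim: s => [|i s IH]; first exact: rm_fun_cst.
  exact: rm_funM (phi1 i) IH.
apply: rm_fun_le (valP A) _; rewrite /= cardE.
apply: eq_rm_fun (H _) => x; apply/allP/forallP => [a i|a i].
  by apply/implyP => iA; apply: a; rewrite mem_enum.
by rewrite mem_enum; apply/implyP.
Qed.

(** * Affine graphs through a given point *)

Section Graph.
Variables (d k : nat) (i0 : Coord d) (p : Coord (d + k)).

Definition dot (a v : Coord d) : bool := \big[addb/false]_j (a j && v j).

(* [p + (y, A y)] with [y = x + i0]: the graph of a linear map
   [A : F_2^d -> F_2^k], translated so that [i0] is sent to [p]. *)
Definition graph (A : {ffun 'I_k -> Coord d}) (x : Coord d) : Coord (d + k) :=
  [ffun l => p l (+) match fintype.split l with
                     | inl j => xorf x i0 j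
                     | inr j => dot (A j) (xorf x i0)
                     end].

Lemma graph_lshift A x j : graph A x (lshift k j) = p (lshift k j) (+) (x j (+) i0 j).
Proof. by rewrite ffunE (unsplitK (inl j)) ffunE. Qed.

Lemma graph_rshift A x j :
  graph A x (rshift d j) = p (rshift d j) (+) dot (A j) (xorf x i0).
Proof. by rewrite ffunE (unsplitK (inr j)). Qed.

Lemma graph_base A : graph A i0 = p.
Proof.
apply/ffunP => l; rewrite ffunE; case: (fintype.split l) => j.
  by rewrite ffunE addbb addbF.
by rewrite [dot _ _]big1 ?addbF// => t _; rewrite ffunE addbb andbF.
Qed.

Lemma graph_inj A : injective (graph A).
Proof.
move=> x y xy; apply/ffunP => j; have := congr1 (fun z : Coord (d + k) => z (lshift k j)) xy.
by rewrite !graph_lshift => /addbI/addIb.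
Qed.

Lemma rm_fun_graph A l : rm_fun 1 (fun x => graph A x l).
Proof.
have H j : rm_fun 1 (fun x => xorf x i0 j).
  apply: eq_rm_fun (rm_funD (rm_fun_var j) (rm_fun_cst _ _ (i0 j))) => x.
  by rewrite ffunE.
pose f x := p l (+) match fintype.split l with
                     | inl j => xorf x i0 j
                     | inr j => dot (A j) (xorf x i0)
                     end.
apply: (@eq_rm_fun _ _ f) => [x|]; first by rewrite ffunE.
apply: rm_funD (rm_fun_cst _ _ _) _; case: (fintype.split l) => j; first exact: H.
by apply: rm_fun_sum => t; case: (A j t) => /=; [exact: H | exact: rm_fun0].
Qed.

(** Adding a unit vector [e] at a position where [v] is nonzero flips the product, which matches the
    two classes. *)
Lemma card_dot_eq (v : Coord d) b : v != [ffun=> false] ->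
  (#|[pred a | dot a v == b]| * 2 = 2 ^ d)%N.
Proof.
move=> v0; have [t vt] : exists t, v t.
  apply/existsP; apply: contraNT v0 => /existsPn v0.
  by apply/eqP/ffunP => t; rewrite ffunE; apply/negbTE.
pose e : Coord d := [ffun j => j == t].
have dote a : dot (xorf a e) v = ~~ dot a v.
  rewrite /dot (bigD1 t)//= [in RHS](bigD1 t)//= !ffunE eqxx vt !andbT addbT addNb.
  congr (~~ (_ (+) _)); apply: eq_bigr => j /negbTE jt.
  by rewrite !ffunE jt addbF.
rewrite -card_Coord -(cardC [pred a | dot a v == b]) muln2 -addnn; congr addn.
rewrite -(fintype.card_image (can_inj (xorfK e)) [pred a | dot a v == b]).
apply: eq_card => a; rewrite -[a in LHS](xorfK e) (fintype.mem_image (can_inj (xorfK e))).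
by rewrite !inE dote; case: (dot a v); case: b.
Qed.

(** Relative to [p], the point [y] reads [(v, w)] and lies on the graph only if [A v = w]. These are
    [k] conditions on separate rows, each met by half of the vectors when [v] is nonzero. *)
Lemma card_graph_hits (y : Coord (d + k)) : y != p ->
  (#|[set A | [exists x, graph A x == y]]| * 2 ^ k <= #|{ffun 'I_k -> Coord d}|)%N.
Proof.
move=> yp; pose v : Coord d := [ffun j => y (lshift k j) (+) p (lshift k j)].
pose w j := y (rshift d j) (+) p (rshift d j).
have hit A : A \in [set A | [exists x, graph A x == y]] ->
    v != [ffun=> false] /\ forall j, dot (A j) v = w j.
  rewrite inE => /existsP[x /eqP xy].
  have vE : v = xorf x i0.
    by apply/ffunP => j; rewrite !ffunE -xy graph_lshift addbC addKb.
  have wE j : dot (A j) v = w j by rewrite /w -xy graph_rshift addbC addKb vE.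
  split => //; apply: contraNneq yp => v0; rewrite -xy -(graph_base A); apply/eqP.
  congr graph; apply/ffunP => j; have := congr1 (fun z : Coord d => z j) v0.
  by rewrite vE !ffunE; case: (x j) (i0 j) => [] [].
(* A graph has only [p] above the base point of [p], so [v = 0] gives no hits. *)
have [v0|v0] := eqVneq v [ffun=> false].
  rewrite (_ : [set A | _] = finset.set0) ?cards0//; apply/setP => A; rewrite [RHS]inE.
  by apply/negP => /hit[]; rewrite v0 eqxx.
apply: (@leq_trans (#|family (fun j => [pred a | dot a v == w j])| * 2 ^ k)).
  rewrite leq_mul2r; apply/orP; right; apply: subset_leq_card; apply/fintype.subsetP => A.
  by move=> /hit[_ Aw]; apply/familyP => j; rewrite inE Aw.
rewrite card_family foldrE big_map big_enum /= card_ffun card_ord card_Coord.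
have -> : (2 ^ k = \prod_(j < k) 2)%N by rewrite prod_nat_const card_ord.
rewrite -big_split /=; under eq_bigr do rewrite card_dot_eq//.
by rewrite prod_nat_const card_ord.
Qed.

End Graph.

(** * Boosting by averaging over graphs *)

Lemma expect_comp (R : realType) (I J : finType) (rho : bool -> R) (phi : I -> J)
    (F : {ffun I -> bool} -> R) : rho true + rho false = 1 -> injective phi ->
  expect rho (fun z : {ffun J -> bool} => F [ffun x => z (phi x)]) = expect rho F.
Proof.
move=> rho1 phi_inj.
rewrite /expect (partition_big (fun z : {ffun J -> bool} => [ffun x => z (phi x)]) predT)//=.
apply: eq_bigr => z' _.
rewrite (eq_bigr (fun z => weight rho z * F z')); last by move=> z /eqP ->.
rewrite -mulr_suml; congr (_ * _).
(* The words restricting to [z'] form a product set: bits on the image of [phi] are pinned, and each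
   other bit is free and contributes mass 1. *)
pose Q y := [pred b | [forall x, (phi x == y) ==> (b == z' x)]].
rewrite (eq_bigl (mem (family Q))) => [|z]; last first.
  apply/eqP/familyP => [zz' y|zQ].
    by rewrite inE; apply/forallP => x; apply/implyP => /eqP <-; rewrite -zz' ffunE.
  apply/ffunP => x; rewrite ffunE; have := zQ (phi x).
  by rewrite inE => /forallP/(_ x); rewrite eqxx => /eqP.
rewrite /weight -(bigA_distr_big_dep (fun y => Q y) (fun _ b => rho b)).
rewrite (bigID (mem [set phi x | x in [set: I]])) /= [X in _ * X]big1 ?mulr1.
  rewrite big_imset /=; last by move=> x y _ _; apply: phi_inj.
  apply: eq_big => [x|x _]; first by rewrite inE.
  rewrite (big_pred1 (z' x)) // => b; apply/forallP/eqP => [/(_ x)|-> x'].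
    by rewrite eqxx => /eqP.
  by apply/implyP => /eqP/phi_inj ->.
move=> y /imsetP yim; rewrite (eq_bigl predT) ?big_bool// => b.
apply/forallP => x; apply/implyP => /eqP xy; case: yim; by exists x.
Qed.

(* Averaging the estimators of the restrictions of the code to all the graphs
   makes them nearly uncorrelated, since two graphs share few points but [p]. *)
Lemma boosted_estimator (R : realType) (d k r : nat) (delta mu : R) (i0 : Coord d)
    (p : Coord (d + k)) (F : {ffun Coord d -> bool} -> R) :
  0 <= delta -> delta <= 1 -> 0 < mu ->
  is_estimator (@rm_codeword d r) i0 F -> mu <= expect (bsc delta) F ->
  exists S : {ffun Coord (d + k) -> bool} -> R,
    (forall (u : Coef (d + k) r) z,
       S (xorf z (rm_codeword u)) = (-1) ^+ rm_codeword u p * S z) /\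
    expect (bsc delta) (fun z => (S z <= 0)%R%:R) <= (2 ^+ k * mu ^+ 2)^-1.
Proof.
move=> delta0 delta1 mu0 [F1 iF Fc] EF.
have rho0 b : 0 <= bsc delta b by exact: bsc_ge0.
have rho1 := bsc_sum delta.
pose T := {ffun 'I_k -> Coord d}.
pose f (A : T) (z : {ffun Coord (d + k) -> bool}) := F [ffun x => z (graph i0 p A x)].
pose S z := \sum_A f A z.
have Ef A : expect (bsc delta) (f A) = expect (bsc delta) F.
  by apply: expect_comp => //; apply: graph_inj.
have ES : expect (bsc delta) S = #|T|%:R * expect (bsc delta) F.
  rewrite expect_sum (eq_bigr (fun=> expect (bsc delta) F)) => [|A _]; last exact: Ef.
  by rewrite sumr_const -[LHS]mulr_natl.
have T0 : 0 < #|T|%:R :> R by rewrite ltr0n card_ffun card_Coord card_ord !expn_gt0.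
exists S; split.
  move=> u z; rewrite /S mulr_sumr; apply: eq_bigr => A _.
  (* The restriction to the graph is a word of [RM(d,r)] whose bit at [i0] is the bit of the
     codeword at [p]. *)
  have [v vE] := rm_fun_comp u (@rm_fun_graph d k i0 p A).
  have -> : rm_codeword u p = rm_codeword v i0.
    by rewrite !rm_codewordE vE graph_base.
  rewrite -Fc; congr F; apply/ffunP => x.
  by rewrite !ffunE; congr (_ (+) _); rewrite -vE.
(* [D p] may be empty although [p] lies on every graph, because [F] ignores position [i0]. *)
pose D y : {set T} := if y == p then finset.set0 else [set A | [exists x, graph i0 p A x == y]].
pose K : R := #|T|%:R / 2 ^+ k.
have fD y A : A \notin D y -> indep y (f A).
  move=> AD z b; rewrite /f; have [yp|yp] := eqVneq y p; last first.
    congr F; apply/ffunP => x; rewrite !ffunE; case: eqP => // xy; case/negP: AD.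
    by rewrite /D (negbTE yp) inE; apply/existsP; exists x; apply/eqP.
  rewrite -(iF [ffun x => z (graph i0 p A x)] b); congr F; apply/ffunP => x.
  have gp : (graph i0 p A x == p) = (x == i0).
    by rewrite -(inj_eq (@graph_inj _ _ i0 p A)) graph_base.
  by rewrite !ffunE yp gp.
have DK y : #|D y|%:R <= K.
  rewrite /D /K; have [yp|yp] := eqVneq y p.
    by rewrite cards0 divr_ge0 ?ltW ?exprn_ge0.
  rewrite ler_pdivlMr ?exprn_gt0// -natrX -natrM ler_nat.
  exact: card_graph_hits.
have K0 : 0 <= K by rewrite divr_ge0 ?(ltW T0) ?exprn_ge0.
have var := variance_sum_le rho0 rho1 K0 fD DK.
set V := _ - _ in var.
have V_le : V <= K * #|T|%:R.
  apply: (le_trans var); rewrite ler_wpM2l// -[leRHS](sumr_const _ 1)/=.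
  apply: ler_sum => A _; rewrite -[leRHS](@expect_cst _ (Coord (d + k)) _ _ rho1).
  apply: le_expect => // z; rewrite -real_normK ?num_real//.
  by rewrite expr_le1//; apply: F1.
set m := expect (bsc delta) S.
have m_ge : #|T|%:R * mu <= m by rewrite /m ES ler_pM2l.
have Tmu : 0 < #|T|%:R * mu by rewrite mulr_gt0.
have m0 : 0 < m by apply: lt_le_trans m_ge.
(* Chebyshev: [V] is the variance of [S], and [S z <= 0] forces [(S z - m) ^+ 2 >= m ^+ 2]. *)
have cheb : m ^+ 2 * expect (bsc delta) (fun z => (S z <= 0)%R%:R) <= V.
  have -> : V = expect (bsc delta) (fun z => (S z - m) ^+ 2).
    rewrite (@eq_expect _ _ _ (fun z => (S z - m) ^+ 2)
       (fun z => S z ^+ 2 + (m ^+ 2 - 2 * m * S z))); last by move=> z; ring.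
    rewrite expectD expectB expectZ expect_cst// -/m /V -/S -/m; ring.
  rewrite -expectZ; apply: le_expect => // z.
  case: (leP (S z) 0) => Sz; last by rewrite mulr0 sqr_ge0.
  have -> : (S z - m) ^+ 2 = m ^+ 2 + (S z ^+ 2 + 2 * (m * - S z)) by ring.
  by rewrite mulr1 lerDl addr_ge0 ?sqr_ge0// !mulr_ge0 ?oppr_ge0 ?(ltW m0).
have key : (#|T|%:R * mu) ^+ 2 * expect (bsc delta) (fun z => (S z <= 0)%R%:R) <=
           #|T|%:R ^+ 2 / 2 ^+ k.
  apply: (@le_trans _ _ (m ^+ 2 * expect (bsc delta) (fun z => (S z <= 0)%R%:R))).
    apply: ler_wpM2r; last by rewrite lerXn2r ?nnegrE ?(ltW m0) ?(ltW Tmu).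
    rewrite -[leLHS](@expect_cst _ (Coord (d + k)) _ _ rho1).
    exact: le_expect.
  apply: (le_trans cheb); apply: (le_trans V_le).
  by rewrite /K expr2 mulrAC.
rewrite -ler_pdivlMl ?exprn_gt0// in key.
apply: (le_trans key); rewrite exprMn.
have p2 : 2 ^+ k != 0 :> R by rewrite expf_neq0.
rewrite le_eqVlt; apply/orP; left; apply/eqP; field.
by rewrite (gt_eqF mu0) (gt_eqF T0) p2.
Qed.

(** * The MAP decision against the sign of an estimator *)

Section MAP.
Context {R : realType}.
Variables (m r : nat) (delta : R).
Hypotheses (delta_ge0 : 0 <= delta) (delta_le1 : delta <= 1).

Lemma Prob_errorE (x : Coord m) (g : {ffun Coord m -> bool} -> bool) :
  Prob delta (fun (u : Coef m r) z => g (received u z) != rm_codeword u x) =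
  \sum_y Prob delta (fun (u : Coef m r) z =>
                       (rm_codeword u x == ~~ g y) && (received u z == y)).
Proof.
rewrite /Prob [RHS]exchange_big; apply: eq_bigr => u _ /=.
rewrite [RHS]exchange_big; apply: eq_bigr => z _ /=.
rewrite [RHS](bigD1 (received u z))//= eqxx andbT big1 ?addr0; last first.
  by move=> y; rewrite eq_sym => /negbTE ->; rewrite andbF.
by case: (g _) (rm_codeword u x) => [] [].
Qed.

(** For each received [y] the two rules either agree or err on opposite events, which the MAP
    inequality compares. *)
Lemma bitMAP_optimal (dec : Coord m -> {ffun Coord m -> bool} -> bool)
    (x : Coord m) (g : {ffun Coord m -> bool} -> bool) : is_bitMAP r delta dec ->
  Prob delta (fun (u : Coef m r) z => dec x (received u z) != rm_codeword u x) <=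
  Prob delta (fun (u : Coef m r) z => g (received u z) != rm_codeword u x).
Proof.
move=> MAP; rewrite (Prob_errorE x (dec x)) (Prob_errorE x g); apply: ler_sum => y _.
have := MAP x y; case: (dec x y) (g y) => [] [] //=.
Qed.

(** By equivariance [S Y] is [(-1) ^+ X_x * S Z], so deciding by [S y < 0] errs only if [S Z <= 0];
    the tie is charged as an error. *)
Lemma Prob_sign_error_le (x : Coord m) (S : {ffun Coord m -> bool} -> R) :
  (forall (u : Coef m r) z,
     S (xorf z (rm_codeword u)) = (-1) ^+ rm_codeword u x * S z) ->
  Prob delta (fun (u : Coef m r) z => (S (received u z) < 0) != rm_codeword u x) <=
  expect (bsc delta) (fun z => (S z <= 0)%R%:R).
Proof.
move=> Sc; set B := expect _ _.
have U0 : 0 < #|{: Coef m r}|%:R :> R by rewrite ltr0n card_ffun card_bool expn_gt0.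
apply: (@le_trans _ _ (\sum_(u : Coef m r) #|{: Coef m r}|%:R^-1 * B)); last first.
  by rewrite sumr_const -[leLHS]mulr_natl mulrA mulfV ?mul1r ?gt_eqF.
apply: ler_sum => u _; rewrite mulr_sumr; apply: ler_sum => z _.
have -> : received u z = xorf z (rm_codeword u).
  by apply/ffunP => y; rewrite !ffunE addbC.
have w0 : 0 <= weight (bsc delta) z by apply: weight_ge0 => b; apply: bsc_ge0.
have U0' : 0 <= #|{: Coef m r}|%:R^-1 :> R by rewrite invr_ge0 ltW.
rewrite Sc /joint_prob -[noise_prob delta z]/(weight (bsc delta) z).
case: ifP => [err|_]; last by rewrite !mulr_ge0.
suff -> : S z <= 0 by rewrite mulr1.
move: err; case: (rm_codeword u x); rewrite ?expr1 ?expr0 ?mulN1r ?mul1r.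
  by rewrite oppr_lt0 eqb_id -leNgt.
by rewrite eqbF_neg negbK => /ltW.
Qed.

End MAP.

(** * Error bound for fixed dimensions *)

Lemma Pbit_le (R : realType) (d k r : nat) (delta eps : R)
    (dec : Coord (d + k) -> {ffun Coord (d + k) -> bool} -> bool) :
  0 <= delta -> delta < 1 / 2 -> 0 < eps ->
  eps <= 1 - (binom_le d r)%:R / 2 ^+ d - binent delta -> is_bitMAP r delta dec ->
  Pbit r delta dec <= (2 ^+ k * (ln 2 * eps) ^+ 2)^-1.
Proof.
move=> delta0 delta_lt eps0 epsle MAP.
have delta1 : delta <= 1 by lra.
have ln20 : 0 < ln 2 :> R by rewrite ln_gt0// ltr1n.
have [i0 [F [estF EF]]] : exists i F, is_estimator (@rm_codeword d r) i F /\
    ln 2 * eps <= expect (bsc delta) F.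
  apply: exists_estimator => //; first exact: rm_codewordD.
    by rewrite card_Coord expn_gt0.
  by rewrite card_Coord card_Mon natrX.
have mu0 : 0 < ln 2 * eps by rewrite mulr_gt0.
apply: bigmax_le => [|p _]; first by rewrite invr_ge0 mulr_ge0 ?sqr_ge0 ?exprn_ge0.
have [S [Sc SB]] := @boosted_estimator R d k r delta _ i0 p F delta0 delta1 mu0 estF EF.
apply: le_trans (bitMAP_optimal p (fun y => S y < 0) MAP) _.
exact: le_trans (Prob_sign_error_le delta0 delta1 Sc) SB.
Qed.

(** * Binomial estimates and the change of rate with the dimension *)

Lemma central_bin_sqr_le j : ('C(j.*2, j) ^ 2 * j.*2.+1 <= 4 ^ j.*2)%N.
Proof.
elim: j => // j IH.
have binS : (j.+1 * 'C(j.+1.*2, j.+1) = 2 * j.*2.+1 * 'C(j.*2, j))%N.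
  rewrite doubleS binS -[X in (_ + X)%N]bin_sub ?leqW// -?addnn ?leq_addr//.
  rewrite subSn ?leq_addr// addKn addnn -[in RHS]mulnA [in RHS]mul_bin_diag; lia.
(* The induction closes by [(2j+1)(2j+3) <= 4(j+1)^2]. *)
have sq : (j.+1 ^ 2 * ('C(j.+1.*2, j.+1) ^ 2 * j.+1.*2.+1) <= j.+1 ^ 2 * 4 ^ j.+1.*2)%N.
  rewrite mulnA -expnMn binS doubleS !expnS.
  set C := 'C(_, _) in IH *; set P := (4 ^ _)%N in IH *; nia.
by rewrite leq_pmul2l in sq.
Qed.

Lemma bin_le_half n k : ('C(n, k) <= 'C(n, n./2))%N.
Proof.
have mono i j : (i + j <= n./2)%N -> ('C(n, i) <= 'C(n, i + j))%N.
  elim: j => [|j IH] ij; first by rewrite addn0.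
  apply: (leq_trans (IH _)); first by lia.
  rewrite addnS -(@leq_pmul2l (i + j).+1)// mul_bin_left leq_mul2r.
  by apply/orP; right; lia.
have [kn|kn] := leqP k n; last by rewrite bin_small.
have [kh|kh] := leqP k n./2; first by rewrite -(subnKC kh) mono// subnKC.
rewrite -bin_sub// (_ : n./2 = n - k + (n./2 - (n - k)))%N ?mono//; lia.
Qed.

Lemma bin_sqr_le n k : ('C(n, k) ^ 2 * n.+1 <= 4 ^ n)%N.
Proof.
apply: (@leq_trans ('C(n, n./2) ^ 2 * n.+1)); first by rewrite leq_mul2r leq_exp2r ?bin_le_half ?orbT.
rewrite -{1 3 4}(odd_double_half n); set j := n./2; case: (odd n); last exact: central_bin_sqr_le.
have := central_bin_sqr_le j.+1; rewrite !add1n.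
(* An odd row reduces to the central coefficient of the next row. *)
have -> : ('C(j.+1.*2, j.+1) = 2 * 'C(j.*2.+1, j))%N.
  rewrite doubleS binS -[X in (X + _)%N]bin_sub; last by lia.
  by rewrite (_ : j.*2.+1 - j.+1 = j)%N; lia.
rewrite doubleS !expnS; set C := 'C(_, _); set P := (4 ^ _)%N; nia.
Qed.

Lemma binom_leS n r : (binom_le n.+1 r + 'C(n, r) = 2 * binom_le n r)%N.
Proof.
elim: r => [|r IH]; first by rewrite /binom_le !big_nat1 !bin0.
have recr l : binom_le l r.+1 = (binom_le l r + 'C(l, r.+1))%N.
  by rewrite /binom_le big_nat_recr.
rewrite !recr binS; lia.
Qed.

(** By [binom_leS], passing from [n] to [n + 1] lowers the rate by half of [C(n,r) / 2^n], which is
    [O(1 / sqrt n)]. Each of the [k] steps is charged [1 / sqrt (d + 1)]. *)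
Lemma rate_drop (R : realType) d k r :
  (binom_le d r)%:R / 2 ^+ d <=
  (binom_le (d + k) r)%:R / 2 ^+ (d + k) + k%:R / Num.sqrt d.+1%:R :> R.
Proof.
have sq n : 0 < Num.sqrt n.+1%:R :> R by rewrite sqrtr_gt0 ltr0n.
have binR n : 'C(n, r)%:R / 2 ^+ n <= (Num.sqrt n.+1%:R)^-1 :> R.
  rewrite ler_pdivrMr ?exprn_gt0// ler_pdivlMl// mulrC.
  rewrite -(@ler_pXn2r _ 2)// ?nnegrE ?mulr_ge0 ?exprn_ge0 ?sqrtr_ge0//.
  rewrite exprMn sqr_sqrtr ?ler0n// -!natrX -natrM ler_nat -expnM.
  by rewrite [(n * 2)%N]mulnC expnM bin_sqr_le.
elim: k => [|k IH]; first by rewrite addn0 mul0r addr0.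
apply: (le_trans IH); rewrite -[k.+1]addn1 natrD mulrDl mul1r addnA addn1.
rewrite addrA [leRHS]addrAC lerD2r.
have step := congr1 (fun n : nat => n%:R : R) (binom_leS (d + k) r).
rewrite natrD natrM in step.
have -> : (binom_le (d + k) r)%:R / 2 ^+ (d + k) =
   (binom_le (d + k).+1 r)%:R / 2 ^+ (d + k).+1 + 'C(d + k, r)%:R / 2 ^+ (d + k) / 2 :> R.
  rewrite exprS; have p0 : 2 ^+ (d + k) != 0 :> R by rewrite expf_neq0.
  by have -> : (binom_le (d + k) r)%:R =
    ((binom_le (d + k).+1 r)%:R + 'C(d + k, r)%:R) / 2 :> R; [lra | field].
rewrite lerD2l; apply: (@le_trans _ _ (Num.sqrt (d + k).+1%:R)^-1).
  apply: le_trans _ (binR _); rewrite ler_pdivrMr//.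
  by rewrite ler_peMr ?ler1n// divr_ge0 ?exprn_ge0.
by rewrite lef_pV2 ?posrE// ler_sqrt ?ltr0n// ler_nat ltnS leq_addr.
Qed.

Lemma rate_le1 (R : realType) m r : (binom_le m r)%:R / 2 ^+ m <= 1 :> R.
Proof.
rewrite ler_pdivrMr ?exprn_gt0// mul1r -natrX ler_nat -card_Mon.
have <- : #|{set 'I_m}| = (2 ^ m)%N.
  by rewrite -cardsT -powersetT card_powerset cardsT card_ord.
by rewrite card_sig max_card.
Qed.

(** * Asymptotics and choice of parameters *)

Lemma limn_sup_lt (R : realType) (u : nat -> R) (a l : R) :
  (forall n, 0 <= u n <= a) -> limn_sup u < l -> exists n0, forall n, (n0 <= n)%N -> u n < l.
Proof.
move=> ua; rewrite limn_supE; last first.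
  exists a; split; first exact: num_real.
  move=> x ax n _; have /andP[u0 un] := ua n.
  by rewrite /= ger0_norm// (le_trans un) ?ltW.
(* Boundedness made [limn_sup] the infimum of the tail suprema, so some tail supremum is already
   below [l]. *)
move=> /inf_lt[]; first by exists (sups u 0%N); exists 0%N.
move=> _ [n0 _ <-] lt; exists n0 => n n0n; apply: le_lt_trans lt.
apply: ub_le_sup; last by exists n.
by exists a => _ [j _ <-]; have /andP[] := ua j.
Qed.

Theorem theorem8p2 (R : realType) (delta : R) (r : nat -> nat) :
  0 <= delta -> delta < 1 / 2 ->
  (forall m : nat, (1 <= m)%N -> (r m <= m)%N) ->
  limn_sup (fun m : nat => (binom_le m (r m))%:R / 2 ^+ m : R) < 1 - binent delta ->
  exists c : R, 0 < c /\
    exists m0 : nat, forall m : nat, (m0 <= m)%N ->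
      forall dec : Coord m -> {ffun Coord m -> bool} -> bool,
        is_bitMAP (r m) delta dec ->
        Pbit (r m) delta dec <= 2 `^ (- (c * Num.sqrt (m%:R))).
Proof.
move=> delta0 delta_lt _.
set L := limn_sup _ => L_lt.
(* The gap is cut in three: one part separates the tail from [L], one pays for the passage from [m]
   to [d], one remains as the [eps] of [Pbit_le]. *)
pose eta := (1 - binent delta - L) / 3.
have eta0 : 0 < eta by rewrite /eta; lra.
have [n0 rate] : exists n0, forall m, (n0 <= m)%N ->
    (binom_le m (r m))%:R / 2 ^+ m < 1 - binent delta - 2 * eta.
  apply: (@limn_sup_lt _ _ 1) => [m|]; last by rewrite -/L /eta; lra.
  by rewrite rate_le1 divr_ge0 ?exprn_ge0.
have ln20 : 0 < ln 2 :> R by rewrite ln_gt0// ltr1n.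
pose mu := ln 2 * eta; have mu0 : 0 < mu by rewrite mulr_gt0.
(* [1 / 2] secures [k <= m] and [sqrt (d + 1) >= s / 2]; given the latter, [eta / 2] keeps the rate
   loss at most [eta]. *)
pose c := Num.min (eta / 2) (1 / 2).
have c0 : 0 < c by rewrite lt_min; apply/andP; split; lra.
have ceta : c <= eta / 2 by rewrite /c ge_min lexx.
have c_half : c <= 1 / 2 by rewrite /c ge_min lexx orbT.
(* The 2 in [B] pays for rounding [k] down. For [s >= X], half of the exponent [c * s] absorbs
   [B]. *)
pose B := 2 / mu ^+ 2; have B0 : 0 < B by rewrite divr_gt0// exprn_gt0.
pose X := ln B / ln 2 / (c / 2).
exists (c / 2); split; first by rewrite divr_gt0.
exists (maxn n0 (Num.truncn (X ^+ 2)).+1) => m; rewrite geq_max => /andP[n0m Xm] dec MAP.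
set s := Num.sqrt m%:R.
have m1 : 1 <= m%:R :> R by rewrite ler1n (leq_ltn_trans _ Xm).
have s1 : 1 <= s by rewrite -sqrtr1 ler_sqrt// (le_trans _ m1).
have ss : s * s = m%:R by rewrite -expr2 sqr_sqrtr.
have Xs : X <= s.
  apply: (le_trans (ler_norm X)); rewrite -sqrtr_sqr ler_sqrt ?ler0n//.
  by apply: ltW; apply: lt_le_trans (truncnS_gt _) _; rewrite ler_nat.
pose k := Num.truncn (c * s).
have cs0 : 0 <= c * s by rewrite mulr_ge0 ?(ltW c0)// (le_trans ler01).
have k_le : k%:R <= c * s by rewrite truncn_le.
have k_gt : c * s < k%:R + 1 by rewrite natr1; exact: truncnS_gt.
have km : (k <= m)%N by rewrite -(ler_nat R); nra.
have [d md] : exists d, m = (d + k)%N by exists (m - k)%N; rewrite subnK.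
have dE : d%:R = m%:R - k%:R :> R by rewrite md natrD addrK.
have sd : s / 2 <= Num.sqrt d.+1%:R.
  rewrite -(@ler_pXn2r _ 2) ?nnegrE ?sqrtr_ge0 ?divr_ge0 ?sqrtr_ge0//.
  rewrite sqr_sqrtr ?ler0n// -[d.+1%:R]natr1 dE -ss expr2; nra.
have drop : k%:R / Num.sqrt d.+1%:R <= eta.
  rewrite ler_pdivrMr; last by apply: lt_le_trans sd; lra.
  by apply: (le_trans k_le); nra.
have eps_le : eta <= 1 - (binom_le d (r m))%:R / 2 ^+ d - binent delta.
  have := rate m n0m; have := rate_drop R d k (r m); rewrite -md.
  set a := _ / _; set b := _ / _; lra.
have Pb : Pbit (r m) delta dec <= (2 ^+ k * mu ^+ 2)^-1.
  (* The types of [dec] and [MAP] depend on [m], so [m = d + k] is eliminated with both in the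
     goal. *)
  move: (r m) MAP eps_le => rm; rewrite /mu; clear -delta0 delta_lt eta0 md.
  by case: _ / (esym md) dec => dec MAP eps_le; apply: Pbit_le.
have pos : 0 < 2 ^+ k * mu ^+ 2 by apply: mulr_gt0; apply: exprn_gt0.
apply: (le_trans Pb); rewrite powRN lef_pV2 ?posrE ?powR_gt0//.
have muB : mu ^+ 2 = 2 / B by rewrite /B; field; rewrite gt_eqF.
have BE : B = 2 `^ (ln B / ln 2).
  by rewrite /powR pnatr_eq0/= divfK ?gt_eqF// lnK ?posrE.
rewrite muB mulrA ler_pdivlMr// {1}BE -powRD; last by rewrite pnatr_eq0 implybT.
rewrite -exprSr -powR_mulrn// -[k.+1%:R]natr1.
apply: ler_powR; first by rewrite ler1n.
apply: le_trans (ltW k_gt); rewrite [leRHS](_ : _ = c / 2 * s + c / 2 * s); last by field.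
by rewrite lerD2l [leRHS]mulrC -ler_pdivrMr// divr_gt0.
Qed.
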